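(* Let $\alpha>-\frac12$ and $\lambda\ge 0$. Let $\{Q^{(\alpha)}_{n,\lambda}\}_{n\ge 0}$ be the sequence of monic Gegenbauer-Sobolev orthogonal polynomials, let $M_{n,\lambda}$ be the associated point to the right of the largest zero of $Q^{(\alpha)}_{n,\lambda}$, and let $\{q^{(\alpha)}_{n,\lambda}\}_{n\ge 0}$ be the sequence of normalized polynomials $$q^{(\alpha)}_{n,\lambda}(x):=\frac{Q^{(\alpha)}_{n,\lambda}(x)}{Q^{(\alpha)}_{n,\lambda}(M_{n,\lambda})},\qquad x\in[-M_{n,\lambda},M_{n,\lambda}],\quad n\ge 0,$$ all as defined in the context. Then, for $\alpha>-\frac12$ and $1\le k\le n$, the function $\left|\frac{d^k}{dx^k}q^{(\alpha)}_{n,\lambda}\right|$ attains its maximal value on the interval $[-M_{n,\lambda},M_{n,\lambda}]$ at the end-points.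
   Context: For $\alpha>-\frac12$ and $\lambda\ge0$, consider on the space of polynomials with real coefficients the Gegenbauer-Sobolev inner product $$\langle f,g\rangle_S:=\int_{-1}^1 f(x)g(x)(1-x^2)^{\alpha-\frac12}\,dx+\lambda\int_{-1}^1 f'(x)g'(x)(1-x^2)^{\alpha-\frac12}\,dx.$$ $\{Q^{(\alpha)}_{n,\lambda}\}_{n\ge0}$ denotes the sequence of monic orthogonal polynomials with respect to $\langle\cdot,\cdot\rangle_S$, where $\deg Q^{(\alpha)}_{n,\lambda}=n$. Known facts from the literature: $Q^{(\alpha)}_{n,\lambda}(-x)=(-1)^nQ^{(\alpha)}_{n,\lambda}(x)$, and all zeros of $Q^{(\alpha)}_{n,\lambda}$ are real and simple (for $-\frac12<\alpha<\frac12$ at most one pair of zeros, symmetric with respect to the origin, lies outside $[-1,1]$; for $\alpha\ge\frac12$ all zeros lie in $[-1,1]$). Let $x_{n,\lambda}^{\alpha,[1]}<x_{n,\lambda}^{\alpha,[2]}<\cdots<x_{n,\lambda}^{\alpha,[n]}$ be the zeros of $Q^{(\alpha)}_{n,\lambda}$, and let $N$ be the maximum value attained by $|Q^{(\alpha)}_{n,\lambda}(x)|$ on the interval $[x_{n,\lambda}^{\alpha,[1]},x_{n,\lambda}^{\alpha,[n]}]$. The point $M_{n,\lambda}$ (which also depends on $\alpha$) is defined to be the minimal real point such that $x_{n,\lambda}^{\alpha,[n]}<M_{n,\lambda}$ and $|Q^{(\alpha)}_{n,\lambda}(M_{n,\lambda})|=N$. All zeros of $Q^{(\alpha)}_{n,\lambda}$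 then lie in $[-M_{n,\lambda},M_{n,\lambda}]$. *)

(* Defs.v *)
From HB Require Import structures.
From mathcomp Require Import all_boot all_order all_algebra.
From mathcomp Require Import all_classical all_reals all_analysis.

Set Implicit Arguments.
Unset Strict Implicit.
Unset Printing Implicit Defensive.

Import Order.TTheory GRing.Theory Num.Theory.
Import numFieldNormedType.Exports.

Local Open Scope classical_set_scope.
Local Open Scope ring_scope.

Section GegenbauerSobolev.
Variable R : realType.
Implicit Types (alpha lambda M N a b c : R) (f g p : {poly R}).

(* At x = 1 and x = -1 the value of the power 0 `^ _ is a convention; these
   points have Lebesgue measure 0. *)
Definition gegenbauer_weight alpha (x : R) : R :=
  (1 - x ^+ 2) `^ (alpha - 2^-1).

(* Lebesgue integrals: for -1/2 < alpha < 1/2 the weight is unbounded. *)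
Definition sobolev_product alpha lambda f g : R :=
  \int[lebesgue_measure]_(x in `[-1, 1])
    (f.[x] * g.[x] * gegenbauer_weight alpha x) +
  lambda * \int[lebesgue_measure]_(x in `[-1, 1])
    (f^`().[x] * g^`().[x] * gegenbauer_weight alpha x).

Definition monic_sobolev_orthogonal alpha lambda (Q : nat -> {poly R}) : Prop :=
  [/\ forall n, size (Q n) = n.+1,
      forall n, Q n \is monic
    & forall m n, m <> n -> sobolev_product alpha lambda (Q m) (Q n) = 0].

(* x`_0 < x`_1 < ... < x`_n.-1 are the zeros of p. *)
Definition increasing_zeros (n : nat) p (x : seq R) : Prop :=
  [/\ size x = n, sorted <%R x & forall t : R, root p t = (t \in x)].

Definition attains_max_at (h : R -> R) a b c : Prop :=
  a <= c <= b /\ forall t, a <= t <= b -> h t <= h c.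

Definition is_max_value (h : R -> R) a b N : Prop :=
  exists2 c, attains_max_at h a b c & h c = N.

(* M is the least real number to the right of the largest zero at which |p|
   takes its maximal value N between the extreme zeros. For n = 1 the two
   extreme zeros coincide, N = 0, and no such point exists; any M to the right
   of the zero is then allowed. *)
Definition is_sobolev_point (n : nat) p M : Prop :=
  exists x : seq R,
    [/\ increasing_zeros n p x,
        x`_n.-1 < M
      & (1 < n)%N -> exists N : R,
        [/\ is_max_value (fun t => `|p.[t]|) x`_0 x`_n.-1 N,
            `|p.[M]| = N
          & forall y, x`_n.-1 < y -> `|p.[y]| = N -> M <= y]].

Definition normalized_at p M : {poly R} := (p.[M])^-1 *: p.

End GegenbauerSobolev.

(* Main.v *)
Require Import Defs.
From HB Require Import structures.
From mathcomp Require Import all_boot all_order all_algebra.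
From mathcomp Require Import all_classical all_reals all_analysis.
From mathcomp Require Import polyrcf measurable_realfun ring lra.

(* Only three properties of Q_n matter: it has n simple real zeros in ]-M, M[,
   it satisfies Q_n(-x) = (-1)^n Q_n(x) (orthogonality and the symmetry of the
   weight), and |Q_n| <= |Q_n(M)| on [-M, M]. If f has these properties then so
   has f', by Rolle's theorem and the claim that |f'| is maximal at the
   end-points; the theorem follows by iteration.

   Proof of the claim, scaled so that M = 1 and f(1) = 1. Let
   mu = f'(1) = sum 1 / (1 - x_i), and suppose that D = max |f'| > mu is
   attained at z in [0, 1[, so that f''(z) = 0. Then 1 - z >= 2 / mu, because z
   is less than the largest critical point t, where f(t) <= 0, and f' lies below
   its chord on [t, 1]. Put eta = 2 / D < 1 - z.
   (i) As the zeros x_i are real, |f(z + i eta)|^2 = prod ((z - x_i)^2 + eta^2)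
   exceeds f(z + eta) f(z - eta) = prod ((z - x_i)^2 - eta^2) >= -1 by at least
   2 eta^2 (f'^2 - f f'')(z) = 8; hence |f(z + i eta)|^2 >= 7.
   (ii) On the lines Re = 1 and Re = -1, |f(x + iy)|^2 = prod (1 + y^2 u_i^2)
   with u_i = 1 / (1 - x_i), which is at most exp (9/10 mu y) because
   1 + a^2 <= exp (9/10 a). By the maximum principle the same bound holds on the
   half-strip, so |f(z + i eta)|^2 <= exp (9/5) < 7. *)

Set Implicit Arguments.
Unset Strict Implicit.
Unset Printing Implicit Defensive.

Import Order.TTheory GRing.Theory Num.Theory.
Import numFieldNormedType.Exports.

Local Open Scope ring_scope.

Local Notation prodX rs := (\prod_(r <- rs) ('X - r%:P)).

(** * A maximum principle for real-rooted polynomials *)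

(** With h = eta^2, [a] is |p(x + i eta)|^2 and [b] is p(x + eta) p(x - eta). A new root [r], with d
    = (x - r)^2, turns a - b into d (a - b) + h (a + b), a + b into d (a + b) + h (a - b), and p'^2
    - p p'' into p^2 + d (p'^2 - p p''). The three bounds therefore feed one another and are proved
    by a single induction. *)
Lemma prod_sqrD_sub_ge (R : realDomainType) (rs : seq R) (x h : R) :
  0 <= h ->
  let p := \prod_(r <- rs) ('X - r%:P) in
  let a := \prod_(r <- rs) ((x - r) ^+ 2 + h) in
  let b := \prod_(r <- rs) ((x - r) ^+ 2 - h) in
  [/\ p.[x] ^+ 2 *+ 2 <= a + b,
      (p^`().[x] ^+ 2 - p.[x] * p^`()^`().[x]) * h *+ 2 <= a - b
    & 0 <= a - b].
Proof.
move=> h0 /=; elim: rs => [|r rs [H1 H2 H3]].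
  by rewrite !big_nil !derivC !hornerE/=; split; lra.
rewrite !big_cons; set p := \prod_(j <- rs) _ in H1 H2 *.
set a := \prod_(j <- rs) _ in H1 H2 H3 *.
set b := \prod_(j <- rs) _ in H1 H2 H3 *.
rewrite derivM derivXsubC mul1r derivD derivM derivXsubC mul1r !hornerE /=.
set u := p.[x] in H1 H2 *; set v := p^`().[x] in H2 *.
set w := p^`()^`().[x] in H2 *.
have d0 : 0 <= (x - r) ^+ 2 by exact: sqr_ge0.
have e0 : 0 <= u ^+ 2 by exact: sqr_ge0.
have K1 : 0 <= (x - r) ^+ 2 * (a + b - u ^+ 2 *+ 2).
  by apply: mulr_ge0 => //; lra.
have K2 : 0 <= (x - r) ^+ 2 * (a - b - (v ^+ 2 - u * w) * h *+ 2).
  by apply: mulr_ge0 => //; lra.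
have K3 : 0 <= h * (a - b) by exact: mulr_ge0.
have K4 : 0 <= h * (a + b - u ^+ 2 *+ 2) by apply: mulr_ge0 => //; lra.
have K5 : 0 <= (x - r) ^+ 2 * (a - b) by exact: mulr_ge0.
have K6 : 0 <= h * u ^+ 2 by exact: mulr_ge0.
split; lra.
Qed.

(* With [z = d + i y] the right-hand side is [|z^4 - s^4|^2]. *)
Lemma four_point_factor_ge (R : realFieldType) (d y s : R) : 0 < s < y ->
  (d ^+ 2 + y ^+ 2) ^+ 4 * (1 - s ^+ 4 / y ^+ 4) ^+ 2 <=
  ((d + s) ^+ 2 + y ^+ 2) * ((d - s) ^+ 2 + y ^+ 2) *
  (d ^+ 2 + (y + s) ^+ 2) * (d ^+ 2 + (y - s) ^+ 2).
Proof.
move=> /andP[s0 sy]; have y0 : 0 < y by exact: lt_trans sy.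
set rho := d ^+ 2 + y ^+ 2.
have d0 : 0 <= d ^+ 2 by exact: sqr_ge0.
have rho_ge : y ^+ 4 <= rho ^+ 2.
  have -> : y ^+ 4 = (y ^+ 2) ^+ 2 by rewrite -exprM.
  by rewrite ler_pXn2r ?nnegrE ?addr_ge0 ?sqr_ge0// /rho lerDr.
apply: (@le_trans _ _ ((rho ^+ 2 - s ^+ 4) ^+ 2)); last first.
  have -> : ((d + s) ^+ 2 + y ^+ 2) * ((d - s) ^+ 2 + y ^+ 2) *
    (d ^+ 2 + (y + s) ^+ 2) * (d ^+ 2 + (y - s) ^+ 2) =
    (rho ^+ 2 - s ^+ 4) ^+ 2 + (4 * s ^+ 2 * d * y) ^+ 2 by rewrite /rho; ring.
  by rewrite lerDl sqr_ge0.
have sy4 : s ^+ 4 <= y ^+ 4 by rewrite ler_pXn2r ?nnegrE// ltW.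
have y4 : 0 < y ^+ 4 by rewrite exprn_gt0.
have s4 : 0 <= s ^+ 4 by rewrite exprn_ge0// ltW.
have st : 0 <= s ^+ 4 / y ^+ 4 <= 1.
  by rewrite divr_ge0 ?(ltW y4)//= ler_pdivrMr// mul1r.
have -> : rho ^+ 4 * (1 - s ^+ 4 / y ^+ 4) ^+ 2 =
  (rho ^+ 2 * (1 - s ^+ 4 / y ^+ 4)) ^+ 2 by ring.
rewrite ler_pXn2r ?nnegrE//; last 2 first.
- by rewrite mulr_ge0 ?sqr_ge0//; lra.
- by lra.
by rewrite mulrBr mulr1 lerD2l lerN2 mulrA ler_pdivlMr// mulrC ler_wpM2r.
Qed.

Lemma four_point_prod_ge (R : realFieldType) (rs : seq R) (x y s : R) :
  0 < s < y ->
  let A := fun x y => \prod_(r <- rs) ((x - r) ^+ 2 + y ^+ 2) in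
  A x y ^+ 4 * (1 - s ^+ 4 / y ^+ 4) ^+ (size rs).*2 <=
  A (x + s) y * A (x - s) y * A x (y + s) * A x (y - s).
Proof.
move=> sy /=; have q0 : 0 <= (1 - s ^+ 4 / y ^+ 4) ^+ 2 by exact: sqr_ge0.
elim: rs => [|r rs IH]; first by rewrite !big_nil expr0 expr1n !mulr1.
rewrite !big_cons /= -muln2 mulSn exprD muln2.
rewrite exprMn [leLHS]mulrACA [X in _ <= X * _ * _]mulrACA.
rewrite [X in _ <= X * _]mulrACA [leRHS]mulrACA.
rewrite -[x + s - r]addrAC -[x - s - r]addrAC.
apply: (ler_pM _ _ (four_point_factor_ge (x - r) sy) IH).
- by rewrite mulr_ge0// exprn_ge0// addr_ge0 ?sqr_ge0.
- rewrite -mul2n exprM mulr_ge0 ?(exprn_ge0 _ q0)// exprn_ge0//.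
  by rewrite prodr_ge0// => i _; rewrite addr_ge0 ?sqr_ge0.
Qed.

Lemma bernoulli (R : realFieldType) (t : R) n :
  0 <= t <= 1 -> 1 - n%:R * t <= (1 - t) ^+ n.
Proof.
move=> /andP[t0 t1]; elim: n => [|n IH]; first by rewrite mul0r subr0 expr0.
rewrite exprS; have := ler_wpM2l (_ : 0 <= 1 - t) IH.
rewrite subr_ge0 => /(_ t1); apply: le_trans.
have := mulr_ge0 (ler0n R n) (mulr_ge0 t0 t0); lra.
Qed.

Lemma series_exp_coeff_le (R : realType) (x : R) n :
  0 <= x -> series (exp_coeff x) n <= expR x.
Proof.
move=> x0; apply: (nondecreasing_cvgn_le _ (is_cvg_series_exp_coeff x)).
by apply: nondecreasing_series => i _ _; exact: exp_coeff_ge0.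
Qed.

Lemma cubic_le_expR (R : realType) (x : R) :
  0 <= x -> 1 + x + x ^+ 2 / 2 + x ^+ 3 / 6 <= expR x.
Proof.
move=> /(series_exp_coeff_le 4); apply: le_trans.
rewrite /series/= !big_nat_recr//= big_geq// /exp_coeff/= !factS fact0.
by rewrite expr0 expr1; lra.
Qed.

(** The rate 9/10 leads to the final bound exp (9/5) < 7; the rate 1 would give exp 2, which exceeds
    7. *)
Lemma add1_sqr_le_expR (R : realType) (a : R) :
  0 <= a -> 1 + a ^+ 2 <= expR (9 / 10 * a).
Proof.
move=> a0; have /cubic_le_expR : 0 <= 9 / 10 * a by lra.
apply: le_trans; rewrite -subr_ge0.
(* The cubic lower bound minus 1 + a^2 is [a] times a quadratic with minimum near 5/2; once this
   square is removed, only positive coefficients remain. *)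
have K1 : 0 <= a * ((9 / 10) ^+ 3 / 6 * (a - 5 / 2) ^+ 2).
  by rewrite mulr_ge0// mulr_ge0// sqr_ge0.
have K2 : 0 <= a ^+ 2 by exact: sqr_ge0.
lra.
Qed.
(** Used on three sides of a rectangle, with [d r] the distance from [r] to an end-point of [-1, 1];
    the sum of inverses is then the logarithmic derivative there, up to sign. *)
Lemma prod_le_expR (R : realType) (rs : seq R) (f d : R -> R) (c : R) :
  {in rs, forall r, 0 <= f r <= d r ^+ 2 * expR (c * (d r)^-1)} ->
  \prod_(r <- rs) f r <=
  \prod_(r <- rs) d r ^+ 2 * expR (c * \sum_(r <- rs) (d r)^-1).
Proof.
move=> H; rewrite big_distrr/= expR_sum -big_split/= big_seq [leRHS]big_seq.
exact: ler_prod.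
Qed.

(* The product of the values of G at the four points at distance s along the axes
   is at least G(x, y)^4 (1 + 2 eps s^2 - O(s^4)), the gain coming from
   exp (eps x^2). *)
Lemma weighted_prod_no_interior_max (R : realType) (rs : seq R)
    (c eps x y m : R) :
  let G := fun x y => \prod_(r <- rs) ((x - r) ^+ 2 + y ^+ 2) *
                      expR (eps * x ^+ 2 - c * y) in
  0 < eps -> 0 < m < y ->
  (forall s, 0 < s <= m -> [/\ G (x + s) y <= G x y, G (x - s) y <= G x y,
     G x (y + s) <= G x y & G x (y - s) <= G x y]) -> False.
Proof.
move=> G eps0 /andP[m0 my] Gmax; have y0 : 0 < y by exact: lt_trans my.
pose a : R := (size rs).*2%:R / y ^+ 4.
have a0 : 0 <= a by rewrite divr_ge0// exprn_ge0// ltW.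
(* [T] is the square of the step s: the first bound gives s <= m, the second makes the loss of order
   T^2 smaller than the gain of order T. *)
pose T := Num.min (m ^+ 2) (eps / ((1 + 2 * eps) * (1 + a))).
have den0 : 0 < (1 + 2 * eps) * (1 + a) by apply: mulr_gt0; lra.
have T0 : 0 < T by rewrite lt_min exprn_gt0//= divr_gt0.
have Tm : T <= m ^+ 2 by rewrite ge_min lexx.
have Teps : T * ((1 + 2 * eps) * (1 + a)) <= eps.
  by rewrite -ler_pdivlMr// ge_min lexx orbT.
pose s := Num.sqrt T.
have s0 : 0 < s by rewrite sqrtr_gt0.
have s2 : s ^+ 2 = T by rewrite sqr_sqrtr// ltW.
have sm : s <= m 
  by rewrite -[m]ger0_norm ?(ltW m0)// -sqrtr_sqr ler_wsqrtr.
have sy : 0 < s < y by rewrite s0/= (le_lt_trans sm).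
have [G1 G2 G3 G4] := Gmax s (introT andP (conj s0 sm)).
have Gpos u v : 0 <= G u v.
  rewrite mulr_ge0 ?expR_ge0// prodr_ge0// => r _.
  by rewrite addr_ge0 ?sqr_ge0.
have le4 : G (x + s) y * G (x - s) y * G x (y + s) * G x (y - s) <= G x y ^+ 4.
  rewrite -[4%N]/(2 + 2)%N exprD !expr2 -[leLHS]mulrA.
  by apply: (ler_pM (mulr_ge0 (Gpos _ _) (Gpos _ _))
    (mulr_ge0 (Gpos _ _) (Gpos _ _)) (ler_pM (Gpos _ _) (Gpos _ _) G1 G2)
    (ler_pM (Gpos _ _) (Gpos _ _) G3 G4)).
pose A u v := \prod_(r <- rs) ((u - r) ^+ 2 + v ^+ 2).
have Apos : 0 < A x y.
  by apply: prodr_gt0 => r _; rewrite ltr_wpDl ?sqr_ge0// exprn_gt0.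
pose E := expR (eps * x ^+ 2 - c * y).
have E0 : 0 < E by exact: expR_gt0.
have HE : A (x + s) y * A (x - s) y * A x (y + s) * A x (y - s) *
    (E ^+ 4 * expR (2 * eps * T)) <= A x y ^+ 4 * E ^+ 4.
  rewrite -exprMn -/(G x y); apply: le_trans le4.
  (* The shifts of y cancel, and (x + s)^2 + (x - s)^2 + 2 x^2 = 4 x^2 + 2 s^2. *)
  have -> : E ^+ 4 * expR (2 * eps * T) =
    expR (eps * (x + s) ^+ 2 - c * y) * expR (eps * (x - s) ^+ 2 - c * y) *
    expR (eps * x ^+ 2 - c * (y + s)) * expR (eps * x ^+ 2 - c * (y - s)).
    by rewrite /E -expRM_natl -!expRD -s2; congr expR; ring.
  rewrite [leLHS]mulrA le_eqVlt; apply/orP; left; apply/eqP.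
  rewrite /G -/(A (x + s) y) -/(A (x - s) y) -/(A x (y + s)) -/(A x (y - s)).
  move: (A _ _) (A _ _) (A _ _) (A _ _) (expR _) (expR _) (expR _) (expR _).
  by move=> *; ring.
have HA := four_point_prod_ge rs x sy.
rewrite -/(A x y) -/(A (x + s) y) -/(A (x - s) y) in HA.
rewrite -/(A x (y + s)) -/(A x (y - s)) in HA.
have e0 : 0 < E ^+ 4 * expR (2 * eps * T).
  by rewrite mulr_gt0 ?exprn_gt0 ?expR_gt0.
have := le_trans (ler_wpM2r (ltW e0) HA) HE.
have st : 0 <= s ^+ 4 / y ^+ 4 <= 1.
  have y4 : 0 < y ^+ 4 by rewrite exprn_gt0.
  have s4 : 0 <= s ^+ 4 by rewrite exprn_ge0// ltW.
  rewrite divr_ge0 ?(ltW y4)//= ler_pdivrMr// mul1r.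
  by rewrite ler_pXn2r ?nnegrE ?ltW//; case/andP: sy.
have := bernoulli (size rs).*2 st.
have -> : (size rs).*2%:R * (s ^+ 4 / y ^+ 4) = a * T ^+ 2.
  by rewrite /a -s2; ring.
set q := (1 - _) ^+ _ => q_ge qe_le.
have : q * expR (2 * eps * T) <= 1.
  have AE : 0 < A x y ^+ 4 * E ^+ 4 by rewrite mulr_gt0 ?exprn_gt0.
  rewrite -(ler_pM2l AE) mulr1; apply: le_trans qe_le.
  by rewrite mulrACA.
apply/negP; rewrite -ltNge.
have e_ge := expR_ge1Dx (2 * eps * T).
have aT0 : 0 <= a * T by rewrite mulr_ge0// ltW.
have epsT0 : 0 < eps * T by rewrite mulr_gt0.
have eaT0 : 0 <= eps * (a * T) by rewrite mulr_ge0// ltW.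
have T12 : 2 * T <= 1.
  rewrite -(ler_pM2l eps0) -subr_ge0.
  by move: Teps; nra.
have aT12 : a * T <= eps by nra.
have aTT : a * T ^+ 2 <= 1.
  by nra.
(* The loss a T^2 from Bernoulli's inequality is of second order in T, the gain 2 eps T of first
   order, so the product of the two lower bounds exceeds 1. *)
apply: (@lt_le_trans _ _ ((1 - a * T ^+ 2) * (1 + 2 * eps * T))); last first.
  by apply: ler_pM => //; [lra|nra].
rewrite -subr_gt0.
have -> : (1 - a * T ^+ 2) * (1 + 2 * eps * T) - 1 =
  T * (2 * eps - a * T - 2 * eps * (a * T) * T) by ring.
rewrite mulr_gt0//.
by nra.
Qed.
Lemma sqr_add_sqr_le_expR (R : realType) (d y : R) : 0 < d -> 0 <= y ->
  d ^+ 2 + y ^+ 2 <= d ^+ 2 * expR (9 / 10 * y * d^-1).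
Proof.
move=> d0 y0; have := @add1_sqr_le_expR _ (y / d) (divr_ge0 y0 (ltW d0)).
rewrite mulrA => /(ler_wpM2l (sqr_ge0 d)); apply: le_trans.
by rewrite mulrDr mulr1 -exprMn (mulrC d) divfK// gt_eqF.
Qed.

(** For the top side y = 20, where u = x - r and d = 1 - r. The height 20 ensures 20 / d >= 10, so
    that the cubic term of the exponential alone is at least 101/100 (20 / d)^2; the surplus 400/100
    = 4 absorbs u^2. *)
Lemma sqr_add400_le_expR (R : realType) (u d : R) : 0 < d <= 2 -> `|u| <= 2 ->
  u ^+ 2 + 20 ^+ 2 <= d ^+ 2 * expR (9 / 10 * 20 * d^-1).
Proof.
move=> /andP[d0 d2] u2; pose a := 20 / d.
have a10 : 10 <= a by rewrite ler_pdivlMr//; lra.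
have -> : 9 / 10 * 20 * d^-1 = 9 / 10 * a by rewrite /a; ring.
have da : d ^+ 2 * a ^+ 2 = 20 ^+ 2.
  by rewrite -exprMn /a (mulrC d) divfK// gt_eqF.
have u4 : u ^+ 2 <= 2 ^+ 2.
  by rewrite -real_normK ?num_real// ler_pXn2r ?nnegrE//.
have K1 : (9 / 10 * a) ^+ 3 / 6 <= expR (9 / 10 * a).
  apply: le_trans (cubic_le_expR _); last by lra.
  have := sqr_ge0 (9 / 10 * a); lra.
have K2 : 101 / 100 * a ^+ 2 <= expR (9 / 10 * a).
  apply: le_trans K1; have := mulr_ge0 (sqr_ge0 a) (_ : 0 <= a - 10).
  by rewrite subr_ge0 => /(_ a10); have := sqr_ge0 a; lra.
have := ler_wpM2l (sqr_ge0 d) K2; apply: le_trans.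
rewrite mulrCA da; lra.
Qed.

(** [A x y] is |p(x + iy)|^2 and K = p(1)^2 = p(-1)^2. The half-strip is cut at y = 20 to get a
    compact rectangle, on which G = A exp (eps x^2 - c y) attains its maximum. Interior points are
    excluded by [weighted_prod_no_interior_max], and on each of the four sides G <= K exp eps. The
    term eps is the price of the strict gain in the interior. *)
Lemma prod_add_sqr_le (R : realType) (rs : seq R) (K mu eps : R) :
  let A := fun x y : R => \prod_(r <- rs) ((x - r) ^+ 2 + y ^+ 2) in
  0 < eps -> {in rs, forall r : R, -1 < r < 1} ->
  \prod_(r <- rs) (1 - r) ^+ 2 = K -> \prod_(r <- rs) (1 + r) ^+ 2 = K ->
  \sum_(r <- rs) (1 - r)^-1 = mu -> \sum_(r <- rs) (1 + r)^-1 = mu ->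
  (forall x : R, -1 <= x <= 1 -> A x 0 <= K) ->
  forall x y : R, -1 <= x <= 1 -> 0 <= y <= 20 ->
  A x y <= K * expR (9 / 10 * y * mu + eps).
Proof.
move=> A eps0 rs1 K1 K2 mu1 mu2 AK x y x1 y20.
have K0 : 0 <= K by rewrite -K1 prodr_ge0// => r _; rewrite sqr_ge0.
have A0 (u v : R) : 0 <= A u v.
  by rewrite prodr_ge0// => r _; rewrite addr_ge0 ?sqr_ge0.
pose c := 9 / 10 * mu.
have cE v : c * v = 9 / 10 * v * mu by rewrite /c mulrAC.
pose G (u v : R) := A u v * expR (eps * u ^+ 2 - c * v).
have Gbd (u v : R) : -1 <= u <= 1 -> A u v <= K * expR (c * v) ->
    G u v <= K * expR eps.
  move=> u1 H; apply: (le_trans (ler_wpM2r (expR_ge0 _) H)).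
  rewrite -[leLHS]mulrA -expRD; apply: ler_wpM2l => //; rewrite ler_expR.
  rewrite addrCA subrr addr0 -[leRHS]mulr1 ler_pM2l//; nra.
have mu0 : 0 <= mu.
  rewrite -mu1 big_seq sumr_ge0// => r /rs1 r1.
  by rewrite invr_ge0; lra.
suff: G x y <= K * expR eps.
  move=> /(ler_wpM2r (expR_ge0 (c * y - eps * x ^+ 2))).
  rewrite -[leLHS]mulrA -[leRHS]mulrA -!expRD addrA addrNK subrr expR0 mulr1.
  move=> /le_trans; apply; apply: ler_wpM2l => //; rewrite ler_expR.
  have := mulr_ge0 (ltW eps0) (sqr_ge0 x); rewrite /c; lra.
pose D : set (R * R) := (`[-1, 1] `*` `[0, 20])%classic.
have cD : compact D by apply: compact_setX; exact: segment_compact.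
have cG : continuous (fun z : R * R => G z.1 z.2).
  have cvg2 (f : R * R -> R) : continuous f -> continuous (fun z => f z ^+ 2).
    move=> cf z; apply: (@continuous_comp _ _ _ f (fun u : R => u ^+ 2)).
      exact: cf.
    exact: exprn_continuous.
  have c1 : continuous (fun z : R * R => z.1) by move=> z; exact: cvg_fst.
  have c2 : continuous (fun z : R * R => z.2) by move=> z; exact: cvg_snd.
  move=> z; apply: cvgM.
    apply: (cvg_big (@mul_continuous R)) => r _.
    apply: cvgD; last exact: cvg2.
    apply: (cvg2 (fun z => z.1 - r)) => u.
    by apply: cvgB; [exact: c1|exact: cvg_cst].
  apply: (@continuous_comp _ _ _ (fun z : R * R => eps * z.1 ^+ 2 - c * z.2)
    expR); last exact: continuous_expR.
  by apply: cvgB; (apply: cvgM; first exact: cvg_cst); [exact: cvg2|exact: c2].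
have [||[x0 y0]] := @compact_EVT_max _ _ (fun z => G z.1 z.2) D _ cD.
- by exists (x, y); split; rewrite /= in_itv.
- exact: continuous_subspaceT.
rewrite inE /= => -[/=]; rewrite !in_itv/= => x01 y020 Gmax.
have {}Gmax (u v : R) : -1 <= u <= 1 -> 0 <= v <= 20 -> G u v <= G x0 y0.
  by move=> u1 v1; apply: (Gmax (u, v)); rewrite inE; split; rewrite /= in_itv.
apply: le_trans (Gmax _ _ x1 y20) _ => {x y x1 y20}.
have [y00|/negP y00] := boolP (y0 == 0).
  by apply: Gbd => //; rewrite (eqP y00) mulr0 expR0 mulr1; exact: AK.
have [/eqP x0e|/negP x0n1] := boolP (x0 == 1).
  apply: Gbd => //; rewrite x0e cE -K1 -mu1.
  apply: prod_le_expR => r /rs1 r1; rewrite addr_ge0 ?sqr_ge0//=.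
  by apply: sqr_add_sqr_le_expR; lra.
have [/eqP x0e|/negP x0n2] := boolP (x0 == -1).
  apply: Gbd => //; rewrite x0e cE -K2 -mu2.
  rewrite /A; under eq_bigr do rewrite -opprD sqrrN.
  apply: prod_le_expR => r /rs1 r1; rewrite addr_ge0 ?sqr_ge0//=.
  by apply: sqr_add_sqr_le_expR; lra.
have [/eqP y0e|/negP y020n] := boolP (y0 == 20).
  apply: Gbd => //; rewrite y0e cE -K1 -mu1.
  apply: prod_le_expR => r /rs1 r1; rewrite addr_ge0 ?sqr_ge0//=.
  by apply: sqr_add400_le_expR; [lra|rewrite ler_norml; lra].
exfalso.
(* Steps up to [m] stay inside the rectangle, and y0 / 2 keeps [m] strictly below y0. *)
pose m := Num.min (y0 / 2) (Num.min (20 - y0) (Num.min (1 - x0) (1 + x0))).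
have y0p : 0 < y0.
  by rewrite lt_neqAle eq_sym; apply/andP; split; [exact/negP|lra].
have y0l : y0 < 20 by rewrite lt_neqAle; apply/andP; split; [exact/negP|lra].
have x0l : x0 < 1 by rewrite lt_neqAle; apply/andP; split; [exact/negP|lra].
have x0g : -1 < x0.
  by rewrite lt_neqAle eq_sym; apply/andP; split; [exact/negP|lra].
apply: (@weighted_prod_no_interior_max _ rs c eps x0 y0 m eps0).
  rewrite !lt_min !gt_min; apply/andP; split; last by apply/orP; left; lra.
  by rewrite divr_gt0// !subr_gt0 y0l x0l/=; lra.
move=> s /andP[s0]; rewrite !le_min => /and4P[s1 s2 s3 s4].
by split; apply: Gmax; lra.
Qed.

(** * The derivative on [[-1, 1]] *)

Lemma horner_prodX (R : comNzRingType) (rs : seq R) (x : R) :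
  (prodX rs).[x] = \prod_(r <- rs) (x - r).
Proof. by rewrite horner_prod; apply: eq_bigr => r _; rewrite !hornerE. Qed.

Lemma deriv_prodX (R : fieldType) (rs : seq R) (x : R) : x \notin rs ->
  (prodX rs)^`().[x] = (prodX rs).[x] * \sum_(r <- rs) (x - r)^-1.
Proof.
elim: rs => [_|r rs IH]; first by rewrite !big_nil derivC !hornerE.
rewrite inE negb_or => /andP[xr xrs]; rewrite !big_cons derivM derivXsubC mul1r.
rewrite hornerD !hornerM IH// !hornerXsubC.
by field; rewrite subr_eq0.
Qed.

Lemma prodX_gt0 (R : realDomainType) (rs : seq R) (x : R) :
  {in rs, forall r, r < x} -> 0 < (prodX rs).[x].
Proof.
move=> H; rewrite horner_prodX big_seq prodr_gt0// => r /H.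
by rewrite subr_gt0.
Qed.

Lemma seq_max (R : realDomainType) (s : seq R) : s != [::] ->
  exists2 t, t \in s & {in s, forall u, u <= t}.
Proof.
elim: s => // a [|b s] IH _.
  by exists a => [|u]; rewrite ?mem_head// inE => /eqP->.
have [//|t ts tmax] := IH; have [at_|ta] := leP a t.
  by exists t => [|u]; rewrite inE ?ts ?orbT// => /predU1P[->|/tmax].
exists a => [|u]; first exact: mem_head.
by rewrite inE => /predU1P[->//|/tmax ut]; rewrite (le_trans ut)// ltW.
Qed.

(* On [[t, 1]] the derivative vanishes at [t] and stays below its chord, while
   [p t <= 0]: this forces [p 1 <= p'(1) (1 - t) / 2]. *)
Lemma inflection_gap (R : realType) (rs ts : seq R) (k x : R) :
  let p := prodX rs in
  0 < k -> p^`() = k *: prodX ts -> {in rs, forall r, r < 1} ->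
  {in ts, forall t, t < 1} -> ts != [::] ->
  p^`()^`().[x] = 0 -> p^`().[x] != 0 ->
  2 * p.[1] <= p^`().[1] * (1 - x).
Proof.
move=> p k0 dp rs1 ts1 ts0 ddp0 dp0.
have tsx : x \notin ts.
  apply: contra dp0 => xts; rewrite dp hornerZ horner_prodX.
  by rewrite (big_rem x)//= subrr mul0r mulr0.
have [t tts tmax] := seq_max ts0.
have t1 : t < 1 by exact: ts1.
(* To the right of all critical points p''/p' is a sum of positive terms 1 / (x - u), so p'' cannot
   vanish there. *)
have xt : x < t.
  rewrite ltNge; apply/negP => tx.
  have tsx' u : u \in ts -> u < x.
    move=> uts; rewrite lt_neqAle (le_trans (tmax u uts) tx) andbT.
    by apply: contraNneq tsx => <-.
  move/eqP: ddp0; rewrite dp derivZ hornerZ deriv_prodX// mulf_eq0 gt_eqF//=.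
  rewrite mulf_eq0 gt_eqF ?prodX_gt0//=; apply/negP; rewrite gt_eqF//.
  case: ts ts0 {dp ts1 tsx t tts tmax t1 tx} tsx' => // u ts _ H.
  rewrite big_cons ltr_wpDr//; last by rewrite invr_gt0 subr_gt0 H ?mem_head.
  rewrite big_seq sumr_ge0// => v vts.
  by rewrite invr_ge0 subr_ge0 ltW// H// inE vts orbT.
have dpt : p^`().[t] = 0.
  rewrite dp hornerZ horner_prodX.
  by rewrite (big_rem t)//= subrr mul0r mulr0.
have dp_chord y : t <= y <= 1 ->
    0 <= p^`().[y] <= p^`().[1] / (1 - t) * (y - t).
  move=> /andP[ty y1]; rewrite dp !hornerZ !horner_prodX.
  have r0 : 0 <= \prod_(u <- rem t ts) (y - u).
    rewrite big_seq prodr_ge0// => u /mem_rem/tmax; lra.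
  have r1 : \prod_(u <- rem t ts) (y - u) <= \prod_(u <- rem t ts) (1 - u).
    rewrite big_seq [leRHS]big_seq ler_prod// => u /mem_rem/tmax; lra.
  rewrite !(big_rem t tts)/= mulr_ge0 ?(ltW k0)//=; last first.
    by apply: mulr_ge0 => //; lra.
  rewrite mulrCA [leRHS](_ : _ = (y - t) * (k * \prod_(u <- rem t ts) (1 - u))).
    by apply: ler_wpM2l; [lra|apply: ler_wpM2l => //; exact: ltW].
  by field; lra.
(* If p(t) > 0, then p, nondecreasing on [t, 1], has no root there; all roots are left of t and the
   logarithmic derivative at t is positive, against p'(t) = 0. *)
have pt0 : p.[t] <= 0.
  rewrite leNgt; apply/negP => pt0.
  have rst : {in rs, forall r, r < t}.
    move=> r rrs; rewrite ltNge; apply/negP => tr.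
    have : p.[t] <= p.[r].
      apply: (@ler_hornerW _ t 1);
        rewrite ?in_itv/= ?lexx ?tr ?(ltW t1) ?(ltW (rs1 _ rrs))//.
      move=> y; rewrite in_itv/= => /andP[ty y1].
      have y1' : t <= y <= 1 by rewrite (ltW ty) (ltW y1).
      by case/andP: (dp_chord y y1').
    rewrite leNgt; move/negP; apply.
    by rewrite [p.[r]]horner_prodX (big_rem r)//= subrr mul0r.
  move/eqP: dpt; rewrite deriv_prodX; last by apply/negP => /rst; rewrite ltxx.
  rewrite mulf_eq0 gt_eqF//=; apply/negP; rewrite gt_eqF//.
  have rs0 : rs != [::].
    apply: contraNneq dp0; rewrite /p => ->.
    by rewrite big_nil derivC horner0.
  case: rs rs0 rst {p dp rs1 ddp0 dp0 dp_chord pt0} => // r rs _ rst.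
  rewrite big_cons ltr_wpDr//; last by rewrite invr_gt0 subr_gt0 rst ?mem_head.
  rewrite big_seq sumr_ge0// => v vts.
  by rewrite invr_ge0 subr_ge0 ltW// rst// inE vts orbT.
(* The quadratic is the primitive of the chord of p' that vanishes at t, so q is nondecreasing on
   [t, 1], and q(t) = - p(t) >= 0. *)
pose q : {poly R} := (p^`().[1] / (1 - t) / 2) *: ('X - t%:P) ^+ 2 - p.
have : q.[t] <= q.[1].
  apply: (@ler_hornerW _ t 1); rewrite ?in_itv/= ?lexx ?(ltW t1)//.
  move=> y; rewrite in_itv/= => /andP[ty y1].
  have y1' : t <= y <= 1 by rewrite (ltW ty) (ltW y1).
  case/andP: (dp_chord y y1') => _.
  rewrite derivB derivZ deriv_exp derivXsubC !hornerE/=.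
  lra.
have -> : q.[t] = - p.[t] by rewrite /q !hornerE/=; ring.
have -> : q.[1] = p^`().[1] * (1 - t) / 2 - p.[1].
  by rewrite /q !hornerE/=; field; lra.
have : 0 <= p^`().[1] * (t - x).
  rewrite mulr_ge0//; last lra.
  by case/andP: (dp_chord 1 (introT andP (conj (ltW t1) (lexx _)))).
lra.
Qed.

(** The 1/100 is the value later given to eps in the maximum principle. Inverting, exp (- 9/5) is
    the 18th power of exp (- 1/10) >= 9/10; the power is taken as 3 * 3 * 2, rounding down to 29/40
    and then 8/21 to keep the fractions small. *)
Lemma expR181_lt7 (R : realType) : expR (9 / 5 + 1 / 100) < 7 :> R.
Proof.
have e1 := expR_ge1Dx (- (1 / 10) : R).
have e2 := expR_ge1Dx (- (1 / 100) : R).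
have E : expR (- (9 / 5 + 1 / 100)) =
    ((expR (- (1 / 10)) ^+ 3) ^+ 3) ^+ 2 * expR (- (1 / 100)) :> R.
  by rewrite -!exprM -expRM_natl -expRD; congr expR; lra.
rewrite -[ltLHS]invrK -expRN {}E.
move: (expR _) (expR _) e1 e2 => v u e1 e2.
have u3 : 29 / 40 <= u ^+ 3.
  apply: le_trans (_ : (9 / 10) ^+ 3 <= _); first lra.
  by apply: lerXn2r; rewrite ?nnegrE; lra.
have u9 : 8 / 21 <= (u ^+ 3) ^+ 3.
  move: (u ^+ 3) u3 => w u3.
  apply: le_trans (_ : (29 / 40) ^+ 3 <= _); first lra.
  by apply: lerXn2r; rewrite ?nnegrE; lra.
move: ((u ^+ 3) ^+ 3) u9 => w u9.
have u18 : (8 / 21) ^+ 2 <= w ^+ 2 by apply: lerXn2r; rewrite ?nnegrE; lra.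
have v99 : 99 / 100 <= v by lra.
have uv : (8 / 21) ^+ 2 * (99 / 100) <= w ^+ 2 * v.
  by apply: ler_pM u18 v99; [exact: sqr_ge0|lra].
have uv7 : 1 / 7 < w ^+ 2 * v by apply: lt_le_trans uv; lra.
rewrite invf_plt ?posrE//; first by move: uv7; rewrite div1r.
by apply: lt_trans uv7; lra.
Qed.

Lemma horner_deriv_sym (R : comNzRingType) (p : {poly R}) (s x : R) :
  p \Po - 'X = s *: p -> p^`().[- x] = - s * p^`().[x].
Proof.
move=> psym; have : (p \Po - 'X)^`().[x] = (s *: p)^`().[x] by rewrite psym.
rewrite deriv_comp derivN derivX derivZ hornerZ hornerM horner_comp !hornerN.
by rewrite hornerX hornerC mulrN1 => /eqP; rewrite eqr_oppLR mulNr => /eqP.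
Qed.

(** The claim for M = 1, with p monic rather than normalised by p(1) = 1, so that powers of p(1)
    accompany the constants: here eta = 2 p(1) / D. The sign [s] is the parity of p. *)
Lemma deriv_prodX_max_at1 (R : realType) (rs ts : seq R) (k s : R) :
  let p := prodX rs in
  0 < k -> p^`() = k *: prodX ts ->
  {in rs, forall r : R, -1 < r < 1} -> {in ts, forall t, t < 1} ->
  s ^+ 2 = 1 -> p \Po - 'X = s *: p ->
  (forall x, -1 <= x <= 1 -> `|p.[x]| <= p.[1]) ->
  forall x, -1 <= x <= 1 -> `|p^`().[x]| <= p^`().[1].
Proof.
move=> p k0 dp rs1 ts1 s2 psym pmax.
have rs1r : {in rs, forall r, r < 1} by move=> r /rs1/andP[].
have p1 : 0 < p.[1] by exact: prodX_gt0.
have dp1 : 0 < p^`().[1] by rewrite dp hornerZ mulr_gt0// prodX_gt0.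
have pN x : p.[- x] = s * p.[x].
  by rewrite -hornerZ -psym horner_comp hornerN hornerX.
have dpN2 x : p^`().[- x] ^+ 2 = p^`().[x] ^+ 2.
  by rewrite (horner_deriv_sym _ psym) exprMn sqrrN s2 mul1r.
move=> x0 x01; rewrite leNgt; apply/negP => dpx0.
(* The square of p' is maximised because it is a polynomial, so its derivative 2 p' p'' must vanish
   at an interior maximum. *)
have [xi xi1 xi_max] : exists2 z, z \in `[-1, 1]%R &
    forall t, t \in `[-1, 1]%R -> (p^`() ^+ 2).[t] <= (p^`() ^+ 2).[z].
  apply: EVT_max; first lra.
  by apply: continuous_subspaceT; exact: continuous_horner.
pose z := `|xi|; pose D := `|p^`().[z]|.
have dpxi : D ^+ 2 = p^`().[xi] ^+ 2.
  rewrite /D real_normK ?num_real// /z.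
  by have [_|_] := ger0P xi; rewrite ?dpN2.
have D0 : 0 <= D by exact: normr_ge0.
have dpD t : -1 <= t <= 1 -> p^`().[t] ^+ 2 <= D ^+ 2.
  by move=> t1; rewrite dpxi -!horner_exp; apply: xi_max; rewrite in_itv.
have Dgt : p^`().[1] < D.
  apply: (lt_le_trans dpx0).
  by rewrite -(@ler_pXn2r _ 2)// ?nnegrE// real_normK ?num_real// dpD.
have z01 : 0 <= z <= 1.
  by rewrite normr_ge0/= ler_norml; move: xi1; rewrite in_itv.
have z1 : z < 1.
  rewrite lt_neqAle; case/andP: (z01) => _ ->; rewrite andbT.
  by apply/eqP => ze; move: Dgt; rewrite /D ze gtr0_norm// ltxx.
have dpz : p^`().[z] != 0 by rewrite -normr_gt0 (lt_trans dp1).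
have ddpz : p^`()^`().[z] = 0.
  have [//|/eqP] := eqVneq (p^`()^`().[z]) 0.
  have h : is_derive z 1 (horner (p^`() ^+ 2)) 0.
    apply: (@derive1_at_max _ _ (-1) 1); rewrite ?in_itv/=; [lra| |lra|].
      by move=> t _; exact: derivable_horner.
    move=> t; rewrite in_itv/= => t1; rewrite !horner_exp.
    by rewrite -[leRHS]real_normK ?num_real// dpD//; lra.
  have h' := is_derive_poly (p^`() ^+ 2) z.
  have : (p^`() ^+ 2)^`().[z] = 0.
    by rewrite -(@derive_val _ _ _ _ _ _ _ h) (@derive_val _ _ _ _ _ _ _ h').
  rewrite deriv_exp hornerMn hornerM expr1 => /eqP.
  by rewrite mulrn_eq0/= mulf_eq0 (negPf dpz) orbF => /eqP.
have [ts0|ts0] := eqVneq ts [::].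
  move: Dgt; rewrite /D dp ts0 big_nil !hornerZ !hornerC.
  by rewrite ger0_norm ?ltxx//; lra.
have gap : 2 * p.[1] <= p^`().[1] * (1 - z).
  exact: (inflection_gap k0 dp rs1r ts1 ts0 ddpz dpz).
have D1 : 0 < D by exact: lt_trans Dgt.
pose eta := 2 * p.[1] / D.
have eta0 : 0 < eta by rewrite divr_gt0// mulr_gt0.
(* As z >= 0, this puts both z + eta and z - eta in [-1, 1], where |p| <= p(1). *)
have eta_gap : eta <= 1 - z.
  rewrite ler_pdivrMr// (le_trans gap)// mulrC ler_wpM2l ?ltW//; lra.
have etaD : eta * D = 2 * p.[1] by rewrite divfK// gt_eqF.
have p1N : p.[-1] = s * p.[1] by exact: pN.
have s0 : s != 0 
  by apply: contra_eq_neq s2 => ->; rewrite expr0n/= eq_sym oner_neq0.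
pose mu := \sum_(r <- rs) (1 - r)^-1.
have dp1E : p^`().[1] = p.[1] * mu.
  by apply: deriv_prodX; apply/negP => /rs1r; rewrite ltxx.
(* By parity the logarithmic derivatives of p at 1 and -1 are opposite. *)
have mu2 : \sum_(r <- rs) (1 + r)^-1 = mu.
  have : p^`().[-1] = p.[-1] * \sum_(r <- rs) (-1 - r)^-1.
    by apply: deriv_prodX; apply/negP => /rs1/andP[]; rewrite ltxx.
  rewrite (horner_deriv_sym _ psym) p1N dp1E mulNr -mulrA.
  have -> : \sum_(r <- rs) (-1 - r)^-1 = - \sum_(r <- rs) (1 + r)^-1.
    by rewrite -sumrN; apply: eq_bigr => r _; rewrite -invrN opprD.
  rewrite !mulrN => /oppr_inj/(mulfI s0)/mulfI -> //.
  by rewrite gt_eqF.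
have AE x : \prod_(r <- rs) ((x - r) ^+ 2 + 0 ^+ 2) = p.[x] ^+ 2.
  rewrite horner_prodX -prodrXl; apply: eq_bigr => r _.
  by rewrite expr0n addr0.
have Kup : \prod_(r <- rs) ((z - r) ^+ 2 + eta ^+ 2) <=
    p.[1] ^+ 2 * expR (9 / 10 * eta * mu + 1 / 100).
  have z11 : -1 <= z <= 1 by lra.
  have eta20 : 0 <= eta <= 20 by lra.
  apply: (prod_add_sqr_le _ rs1 _ _ (erefl mu) mu2 _ z11 eta20); first lra.
  - by rewrite horner_prodX -prodrXl.
  - have -> : p.[1] ^+ 2 = p.[-1] ^+ 2 by rewrite p1N exprMn s2 mul1r.
    rewrite horner_prodX -prodrXl.
    by apply: eq_bigr => r _; rewrite -sqrrN opprD.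
  - move=> x x1; rewrite AE -[leLHS]real_normK ?num_real//.
    by rewrite ler_pXn2r ?nnegrE ?(ltW p1)// pmax.
have [_ H _] := prod_sqrD_sub_ge rs z (sqr_ge0 eta).
have Klow : - p.[1] ^+ 2 <= \prod_(r <- rs) ((z - r) ^+ 2 - eta ^+ 2).
  have -> : \prod_(r <- rs) ((z - r) ^+ 2 - eta ^+ 2) =
      p.[z + eta] * p.[z - eta].
    rewrite !horner_prodX -big_split/=; apply: eq_bigr => r _; ring.
  have : `|p.[z + eta] * p.[z - eta]| <= p.[1] ^+ 2.
    by rewrite normrM expr2 ler_pM//; apply: pmax; lra.
  by rewrite ler_norml => /andP[].
(* Since p''(z) = 0, twice the Laguerre term is 2 D^2 eta^2 = 8 p(1)^2, and [Klow] costs one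
   p(1)^2. *)
have K7 : 7 * p.[1] ^+ 2 <= p.[1] ^+ 2 * expR (9 / 10 * eta * mu + 1 / 100).
  apply: le_trans Kup.
  have : (p^`().[z] ^+ 2 - p.[z] * p^`()^`().[z]) * eta ^+ 2 = 4 * p.[1] ^+ 2.
    rewrite ddpz mulr0 subr0 -[p^`().[z] ^+ 2]real_normK ?num_real// -/D.
    by rewrite -exprMn mulrC etaD exprMn; congr (_ * _); lra.
  move: H => /[swap] ->; lra.
have : expR (9 / 10 * eta * mu + 1 / 100) < 7 :> R.
  apply: lt_trans (expR181_lt7 R); rewrite ltr_expR ltrD2r.
  (* Multiplied by D this reads 2 p(1) mu = 2 p'(1) < 2 D. *)
  suff : eta * mu < 2 by lra.
  rewrite -(ltr_pM2r D1) mulrAC etaD -mulrA -dp1E.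
  by rewrite ltr_pM2l.
apply/negP; rewrite -leNgt.
by rewrite -(@ler_pM2l _ (p.[1] ^+ 2)) ?exprn_gt0// mulrC.
Qed.

(** * Iterated derivatives *)

Lemma rolle_path (R : rcfType) (p : {poly R}) (a M : R) (rs : seq R) :
  root p a -> path <%R a rs -> all (root p) rs -> {in rs, forall r, r < M} ->
  exists ts, [/\ size ts = size rs, path <%R a ts, all (root p^`()) ts
               & {in ts, forall t, t < M}].
Proof.
elim: rs a => [|b rs IH] a pa /=; first by exists [::].
move=> /andP[ab brs] /andP[pb prs] rsM.
have [|ts [ts_size bts pts tsM]] := IH b pb brs prs.
  by move=> r rrs; apply: rsM; rewrite inE rrs orbT.
have [|c] := poly_rolle ab (_ : p.[a] = p.[b]).
  by rewrite (rootP pa) (rootP pb).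
rewrite in_itv/= => /andP[ac cb] pc0; exists (c :: ts); split => /=.
- by rewrite ts_size.
- rewrite ac; case: ts bts {ts_size pts tsM} => //= t ts /andP[bt ->].
  by rewrite (lt_trans cb bt).
- by rewrite pts andbT; exact/rootP.
- move=> t; rewrite inE => /predU1P[->|/tsM//].
  by rewrite (lt_trans cb)// rsM ?mem_head.
Qed.

(** Rolle's theorem between consecutive roots yields as many distinct critical points as the degree
    of the derivative allows, so they are all of its roots. *)
Lemma deriv_prodX_split (R : rcfType) (rs : seq R) (a b : R) :
  rs != [::] -> sorted <%R rs -> {in rs, forall r, a < r < b} ->
  exists ts, [/\ sorted <%R ts, {in ts, forall t, a < t < b}
    & (prodX rs)^`() = (size rs)%:R *: prodX ts].
Proof.
move=> rs0 rs_sorted rsab.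
have rs_size : size (prodX rs) = (size rs).+1 by rewrite size_prod_XsubC.
have rs_root : all (root (prodX rs)) rs.
  by apply/allP => r rrs; rewrite root_prod_XsubC.
case: rs rs0 rs_sorted rsab rs_size rs_root => // r rs _ rs_sorted rsab.
set p := prodX (r :: rs) => p_size /andP[pr prs].
have [|ts [ts_size rts pts tsb]] := rolle_path pr rs_sorted prs (M := b).
  by move=> u urs; have := rsab u; rewrite inE urs orbT => /(_ isT)/andP[].
have ts_sorted : sorted <%R ts by exact: path_sorted rts.
exists ts; split => //.
  move=> t tts; rewrite tsb// andbT.
  have /andP[ar _] := rsab r (mem_head _ _); apply: (lt_trans ar).
  have := rts; rewrite lt_path_sortedE => /andP[/allP rlt _]; exact: rlt.
have dp_size : size p^`() = (size ts).+1.
  by rewrite polyorder.size_deriv p_size/= ts_size.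
rewrite (all_roots_prod_XsubC dp_size pts); last first.
  by rewrite uniq_rootsE lt_sorted_uniq.
congr (_ *: _); rewrite lead_coefE dp_size/= coef_deriv ts_size.
have /monicP : p \is monic by exact: monic_prod_XsubC.
by rewrite lead_coefE p_size/= => ->.
Qed.

(** The invariant carried through the iteration. The factor [c] may be 0, which closes the class
    under differentiation even at constants; [s] is the sign of the parity. *)
Definition oscillating (R : realType) (M : R) (p : {poly R}) :=
  exists (c s : R) (rs : seq R),
  [/\ p = c *: prodX rs, sorted <%R rs, {in rs, forall r, -M < r < M},
      s ^+ 2 = 1 /\ p \Po - 'X = s *: p
    & forall x, -M <= x <= M -> `|p.[x]| <= `|p.[M]|].

Lemma oscillating0 (R : realType) (M : R) : oscillating M 0.
Proof.
exists 0, 1, [::]; rewrite scale0r; split=> //; last first.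
  by move=> x; rewrite !horner0.
by rewrite expr1n comp_poly0 scale1r.
Qed.

Lemma prodX_scale (R : fieldType) (M : R) (rs : seq R) : M != 0 ->
  prodX [seq r / M | r <- rs] = M ^- (size rs) *: (prodX rs \Po (M *: 'X)).
Proof.
move=> M0; elim: rs => [|r rs IH].
  by rewrite !big_nil expr0 invr1 scale1r comp_polyC.
rewrite /= !big_cons IH comp_polyM comp_polyB comp_polyX comp_polyC.
have -> : 'X - (r / M)%:P = M^-1 *: (M *: 'X - r%:P).
  by rewrite scalerBr scalerA mulVf// scale1r scale_polyC mulrC.
by rewrite -scalerAl -scalerAr scalerA -invfM -exprS.
Qed.

(** Dividing the roots by M replaces the monic P by P1(x) = P(M x) / M^n on [-1, 1], to which
    [deriv_prodX_max_at1] applies. Differentiation flips the parity sign. *)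
Lemma oscillating_deriv (R : realType) (M : R) (p : {poly R}) :
  0 < M -> oscillating M p -> oscillating M p^`().
Proof.
move=> M0 [c [s [rs [pE rs_sorted rsM [s2 psym] pmax]]]].
have [c0|c0] := eqVneq c 0.
  by rewrite pE c0 scale0r deriv0; exact: oscillating0.
have [rs0|rs0] := eqVneq rs [::].
  by rewrite pE rs0 big_nil alg_polyC derivC; exact: oscillating0.
have [ts [ts_sorted tsM dP]] := deriv_prodX_split rs0 rs_sorted rsM.
exists (c * (size rs)%:R), (- s), ts; split => //.
- by rewrite pE derivZ dP scalerA.
- rewrite sqrrN s2; split=> //.
  have : (p \Po - 'X)^`() = (s *: p)^`() by rewrite psym.
  rewrite deriv_comp derivN derivX derivZ mulrN1 => /eqP.
  by rewrite eqr_oppLR -scaleNr => /eqP.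
pose P := prodX rs; pose n := size rs.
have M0' : M != 0 by rewrite gt_eqF.
have Psym : P \Po - 'X = s *: P.
  apply: (scalerI c0); rewrite -comp_polyZ scalerA mulrC -scalerA -pE.
  exact: psym.
have Pmax x : -M <= x <= M -> `|P.[x]| <= `|P.[M]|.
  move=> /pmax; rewrite pE !hornerZ !normrM ler_pM2l//.
  by rewrite normr_gt0.
pose P1 := prodX [seq r / M | r <- rs].
have P1E : P1 = M ^- n *: (P \Po (M *: 'X)) by exact: prodX_scale.
have P1x x : P1.[x] = M ^- n * P.[M * x].
  by rewrite P1E hornerZ horner_comp !hornerE.
have dP1x x : P1^`().[x] = M ^- n * M * P^`().[M * x].
  rewrite P1E derivZ deriv_comp derivZ derivX hornerZ hornerM horner_comp.
  by rewrite !hornerE/=; ring.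
have Mn0 : 0 < M ^- n by rewrite invr_gt0 exprn_gt0.
have n0 : 0 < n%:R :> R by rewrite ltr0n /n; case: (rs) rs0.
have ts_size : n = (size ts).+1.
  have : size P^`() = size (n%:R *: prodX ts) by rewrite dP.
  rewrite polyorder.size_deriv size_scale ?gt_eqF// !size_prod_XsubC/=.
  by move=> h; exact: h.
have divM r : (- M < r < M) -> -1 < r / M < 1.
  by rewrite ltr_pdivlMr// ltr_pdivrMr// mulN1r mul1r.
have dP1 : P1^`() = n%:R *: prodX [seq t / M | t <- ts].
  rewrite prodX_scale// P1E derivZ deriv_comp dP derivZ derivX.
  rewrite -scalerAr mulr1 comp_polyZ !scalerA; congr (_ *: _).
  by rewrite mulrC -/n; congr (_ * _); rewrite ts_size exprSr invfM divfK.
have P1sym : P1 \Po - 'X = s *: P1.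
  rewrite P1E comp_polyZ -comp_polyA comp_polyZ comp_polyX.
  have -> : M *: - 'X = - 'X \Po (M *: 'X) :> {poly R}.
    by rewrite -[- 'X]scaleN1r comp_polyZ comp_polyX !scalerA mulrC.
  by rewrite comp_polyA Psym comp_polyZ !scalerA mulrC.
have P1max x : -1 <= x <= 1 -> `|P1.[x]| <= P1.[1].
  move=> x1; have P11 : 0 < P1.[1].
    by apply: prodX_gt0 => _ /mapP[r rrs ->]; case/andP: (divM _ (rsM _ rrs)).
  rewrite -(gtr0_norm P11) !P1x mulr1 !normrM ler_wpM2l//; apply: Pmax.
  case/andP: x1 => /(ler_wpM2l (ltW M0)) a /(ler_wpM2l (ltW M0)) b.
  by move: a b; rewrite mulrN1 mulr1 => -> ->.
move=> x xM.
have xM1 : -1 <= x / M <= 1.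
  by rewrite ler_pdivrMr// ler_pdivlMr// mulN1r mul1r.
have := deriv_prodX_max_at1 n0 dP1 _ _ s2 P1sym P1max xM1.
rewrite !dP1x mulr1 mulrCA divff// mulr1 => H.
rewrite pE !derivZ !hornerZ !normrM ler_wpM2l//.
have {}H : `|M ^- n * M * P^`().[x]| <= M ^- n * M * P^`().[M].
  apply: H => [_ /mapP[r rrs ->]|_ /mapP[t tts ->]].
    exact: divM (rsM _ rrs).
  by case/andP: (divM _ (tsM _ tts)).
have MM : 0 < M ^- n * M by exact: mulr_gt0.
move: H; rewrite normrM (gtr0_norm MM) ler_pM2l// => /le_trans; apply.
exact: ler_norm.
Qed.

(** Between the extreme zeros |p| <= N = |p(M)| by the choice of M. From the largest zero to M all
    factors x - r are nonnegative and increase, so |p| does too; the left side follows by parity. *)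
Lemma sobolev_point_oscillating (R : realType) (n : nat) (p : {poly R})
    (s M : R) :
  (0 < n)%N -> size p = n.+1 -> p \is monic ->
  s ^+ 2 = 1 -> p \Po - 'X = s *: p -> is_sobolev_point n p M ->
  0 < M /\ oscillating M p.
Proof.
move=> n0 p_size p_monic s2 psym [x [[x_size x_sorted x_root] xM HN]].
have x_uniq : uniq x by exact: lt_sorted_uniq.
have pE : p = prodX x.
  rewrite [LHS](@all_roots_prod_XsubC _ p x) ?uniq_rootsE ?p_size ?x_size//.
    by rewrite (monicP p_monic) scale1r.
  by apply/allP => r; rewrite x_root.
have pN y : `|p.[- y]| = `|p.[y]|.
  have -> : p.[- y] = s * p.[y].
    by rewrite -hornerZ -psym horner_comp hornerN hornerX.
  have /eqP : `|s| ^+ 2 = 1 by rewrite -normrX s2 normr1.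
  by rewrite normrM sqrp_eq1// => /eqP ->; rewrite mul1r.
have xN y : y \in x -> - y \in x.
  move=> yx; rewrite -x_root /root -normr_eq0 pN normr_eq0.
  by rewrite -/(root p y) x_root.
have x_max y : y \in x -> y <= x`_n.-1.
  move=> yx; rewrite -(nth_index 0 yx).
  rewrite (lt_sorted_leq_nth 0 x_sorted) ?inE ?index_mem//.
    by rewrite -ltnS prednK// -x_size index_mem.
  by rewrite x_size ltn_predL.
have x_min y : y \in x -> x`_0 <= y.
  move=> yx; rewrite -(nth_index 0 yx).
  by rewrite (lt_sorted_leq_nth 0 x_sorted) ?inE ?index_mem// x_size.
have x0x : x`_0 \in x by rewrite mem_nth// x_size.
have xnx : x`_n.-1 \in x by rewrite mem_nth// x_size ltn_predL.
have xltM y : y \in x -> - M < y < M.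
  move=> yx; rewrite ltrNl !(le_lt_trans (x_max _ _) xM)//; exact: xN.
have M0 : 0 < M by have := xltM _ x0x; lra.
split=> //; exists 1, s, x; split=> //; first by rewrite scale1r.
have outer y : x`_n.-1 <= y <= M -> `|p.[y]| <= `|p.[M]|.
  move=> /andP[y1 y2]; rewrite pE !horner_prodX !ger0_norm; last 2 first.
  - by rewrite big_seq prodr_ge0// => r /xltM; lra.
  - by rewrite big_seq prodr_ge0// => r /x_max; lra.
  by rewrite big_seq [leRHS]big_seq ler_prod// => r /x_max; lra.
move=> y /andP[y1 y2]; have [y3|y3] := leP x`_n.-1 y.
  by rewrite outer ?y3.
have [y4|y4] := ltP y x`_0.
  rewrite -pN outer//; apply/andP; split; last by lra.
  by have := x_min _ (xN _ xnx); lra.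
have [n1|n1] := ltnP 1 n.
  have [N [[c [c1 cmax] cN] pMN _]] := HN n1.
  by rewrite pMN -cN cmax// y4 ltW.
(* For n = 1 the extreme zeros coincide and no point is left between them. *)
have nE : n.-1 = 0%N by case: (n) n1 => [|[]].
by move: y3; rewrite nE ltNge y4.
Qed.

Lemma oscillating_derivn (R : realType) (M : R) (p : {poly R}) k :
  0 < M -> oscillating M p -> oscillating M p^`(k).
Proof.
move=> M0 oscp; elim: k => [|k IH]; first by rewrite derivn0.
by rewrite derivnS; exact: oscillating_deriv.
Qed.

Lemma oscillating_attains_max (R : realType) (M : R) (p : {poly R}) :
  0 < M -> oscillating M p ->
  let h := fun x => `|p.[x]| in
  attains_max_at h (- M) M (- M) /\ attains_max_at h (- M) M M.
Proof.
move=> M0 [c [s [rs [_ _ _ [s2 psym] pmax]]]] h.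
have hN : h (- M) = h M.
  have -> : h (- M) = `|s * p.[M]|.
    by rewrite /h -hornerZ -psym horner_comp hornerN hornerX.
  have /eqP : `|s| ^+ 2 = 1 by rewrite -normrX s2 normr1.
  by rewrite normrM sqrp_eq1// => /eqP ->; rewrite mul1r.
by split; split; rewrite ?hN// ?lexx//=; lra.
Qed.

(** * Symmetry of the orthogonal polynomials *)

Section gegenbauer_weight_theory.
Variables (R : realType) (alpha : R).
Hypothesis alpha_gt : - 2^-1 < alpha.
Local Notation mu := (@lebesgue_measure R).
Local Notation w := (gegenbauer_weight alpha).
Local Notation I := (`[(-1 : R), 1]%classic).
Local Notation I0 := (`](-1 : R), 1[%classic).

Lemma powR_le_antimono (b x y : R) : b <= 0 -> 0 < x <= y -> y `^ b <= x `^ b.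
Proof.
move=> b0 /andP[x0 xy]; have y0 : 0 < y by exact: lt_le_trans xy.
rewrite -[b]opprK !(powRN _ (- b)) lef_pV2 ?posrE ?powR_gt0//.
by apply: ge0_ler_powR => //; rewrite ?oppr_ge0// nnegrE ltW.
Qed.

(** For a negative exponent, 1 - x^2 is at least 1 - x when x >= 0 and at least 1 + x when x < 0;
    for a nonnegative exponent the weight is at most 1. Unlike the weight, the majorant has an
    elementary primitive. *)
Lemma gegenbauer_weight_le (x : R) : -1 < x < 1 ->
  w x <= (1 + x) `^ (alpha - 2^-1) + (1 - x) `^ (alpha - 2^-1) + 1.
Proof.
move=> x1; rewrite /gegenbauer_weight; set b := alpha - 2^-1.
have p1 := powR_ge0 (1 + x) b; have p2 := powR_ge0 (1 - x) b.
have [b0|b0] := leP 0 b.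
  have : (1 - x ^+ 2) `^ b <= 1 `^ b.
    by apply: ge0_ler_powR; rewrite ?nnegrE//; nra.
  by rewrite powR1; lra.
have [x0|x0] := leP 0 x.
  have : (1 - x ^+ 2) `^ b <= (1 - x) `^ b.
    by apply: powR_le_antimono; [exact: ltW|nra].
  lra.
have : (1 - x ^+ 2) `^ b <= (1 + x) `^ b.
  by apply: powR_le_antimono; [exact: ltW|nra].
lra.
Qed.

Lemma measurable_gegenbauer_weight (D : set R) : measurable_fun D w.
Proof.
apply: measurable_funTS; apply: (measurableT_comp (measurable_powR _)).
exact: measurable_funB.
Qed.

(** [G] is the majorant of the weight and [F] a primitive of it, bounded on ]-1, 1[ because b + 1 =
    alpha + 1/2 > 0. *)
Let b := alpha - 2^-1.
Let F (x : R) :=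
  (b + 1)^-1 * (1 + x) `^ (b + 1) - (b + 1)^-1 * (1 - x) `^ (b + 1) + x.
Let G (x : R) := (1 + x) `^ b + (1 - x) `^ b + 1.

Let b1 : 0 < b + 1.
Proof. rewrite /b; have := alpha_gt; lra. Qed.

Let is_derive_powR_add (e c s : R) (x : R) : 0 < c + s * x ->
  is_derive x 1 (fun x => (c + s * x) `^ e) (e * (c + s * x) `^ (e - 1) * s).
Proof.
move=> cx; have H1 := is_derive1_powR e cx.
have H2 : is_derive x 1 (fun x => c + s * x) s.
  by apply: is_derive_eq; rewrite add0r mul1r /GRing.scale/= mulr1.
exact: (@is_derive1_comp R (@powR R ^~ e) (fun x => c + s * x) x _ _ H1 H2).
Qed.

Let is_derive_add_powR (e x : R) : -1 < x ->
  is_derive x 1 (fun x => (1 + x) `^ e) (e * (1 + x) `^ (e - 1)).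
Proof.
move=> x1; have := @is_derive_powR_add e 1 1 x; rewrite mul1r mulr1.
under [X in is_derive _ _ X _]funext do rewrite mul1r.
by apply; lra.
Qed.

Let is_derive_sub_powR (e x : R) : x < 1 ->
  is_derive x 1 (fun x => (1 - x) `^ e) (- (e * (1 - x) `^ (e - 1))).
Proof.
move=> x1; have := @is_derive_powR_add e 1 (-1) x; rewrite mulN1r mulrN1.
under [X in is_derive _ _ X _]funext do rewrite mulN1r.
by apply; lra.
Qed.

Let is_derive_F (x : R) : -1 < x < 1 -> is_derive x 1 F (G x).
Proof.
move=> /andP[x0 x1].
have H1 := is_derive_add_powR (b + 1) x0; rewrite addrK in H1.
have H2 := is_derive_sub_powR (b + 1) x1; rewrite addrK in H2.
rewrite /F /G; apply: is_derive_eq.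
rewrite /GRing.scale/=; field; have := b1; lra.
Qed.

Let continuous_derive (f : R -> R) (x df : R) :
  is_derive x 1 f df -> {for x, continuous f}.
Proof.
by move=> [fx _]; apply: differentiable_continuous; exact/derivable1_diffP.
Qed.

Let continuous_G (x : R) : -1 < x < 1 -> {for x, continuous G}.
Proof.
move=> /andP[x0 x1].
have H1 := is_derive_add_powR b x0; have H2 := is_derive_sub_powR b x1.
have H : is_derive x 1 G (b * (1 + x) `^ (b - 1) - b * (1 - x) `^ (b - 1)).
  by rewrite /G; apply: is_derive_eq; rewrite addr0.
exact: (continuous_derive H).
Qed.

Let F_le : exists C : R, forall x, -1 < x < 1 -> `|F x| <= C.
Proof.
exists ((b + 1)^-1 * 2 `^ (b + 1) + 1) => x x1.
have b10 := b1.
have k0 : 0 < (b + 1)^-1 by rewrite invr_gt0.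
have H1 : (1 + x) `^ (b + 1) <= 2 `^ (b + 1).
  by apply: ge0_ler_powR; rewrite ?nnegrE; lra.
have H2 : (1 - x) `^ (b + 1) <= 2 `^ (b + 1).
  by apply: ge0_ler_powR; rewrite ?nnegrE; lra.
have K1 := ler_wpM2l (ltW k0) H1; have K2 := ler_wpM2l (ltW k0) H2.
have K3 := mulr_ge0 (ltW k0) (powR_ge0 (1 + x) (b + 1)).
have K4 := mulr_ge0 (ltW k0) (powR_ge0 (1 - x) (b + 1)).
rewrite ler_norml /F; move: K1 K2 K3 K4.
move: (_ * _) (_ * _) (_ * _) => u v u'; lra.
Qed.

Let integral_G (a c : R) : -1 < a -> a < c -> c < 1 ->
  (\int[mu]_(x in `[a, c]) (G x)%:E = (F c)%:E - (F a)%:E)%E.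
Proof.
move=> a1 ac c1; apply: continuous_FTC2 => //.
- apply: continuous_in_subspaceT => x; rewrite inE/= in_itv/= => /andP[ax xc].
  by apply: continuous_G; lra.
- split.
  + move=> x; rewrite in_itv/= => /andP[ax xc].
    by have [] : is_derive x 1 F (G x) by apply: is_derive_F; lra.
  + apply: cvg_at_right_filter; apply: (@continuous_derive F a (G a)).
    by apply: is_derive_F; lra.
  + apply: cvg_at_left_filter; apply: (@continuous_derive F c (G c)).
    by apply: is_derive_F; lra.
- move=> x; rewrite in_itv/= => /andP[ax xc].
  have H : is_derive x 1 F (G x) by apply: is_derive_F; lra.
  by rewrite derive1E derive_val.
Qed.

(** Compact intervals exhausting ]-1, 1[, away from the singularities of [G]; the shift by 3 makes
    already the first one nondegenerate. *)
Let J (n : nat) : set R := `[-1 + n.+3%:R^-1, 1 - n.+3%:R^-1]%classic.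

Let bigcup_J : (\bigcup_n J n)%classic = I0.
Proof.
apply/seteqP; split => x.
  move=> [n _]; rewrite /J /= !in_itv/= => /andP[x1 x2].
  have : 0 < n.+3%:R^-1 :> R by rewrite invr_gt0.
  by move: x1 x2; set u := _^-1; lra.
rewrite /= in_itv/= => x1.
pose e := Num.min (1 - x) (1 + x).
have e0 : 0 < e by rewrite lt_min; lra.
have [n _ ne] := near_infty_natSinv_lt (PosNum e0).
exists n => //; rewrite /J/= in_itv/=.
have := ne n (leqnn n); rewrite /= lt_min => /andP[h1 h2].
have : n.+3%:R^-1 <= n.+1%:R^-1 :> R.
  by rewrite lef_pV2 ?posrE// ler_nat; exact: (leq_addl 2 n.+1).
by move: h1 h2; set u := n.+1%:R^-1; set v := n.+3%:R^-1; lra.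
Qed.

(** By monotone convergence along [J] it is enough to bound the integrals over [J n]; there the
    weight is below [G], whose integral is a difference of two values of [F], hence at most 2 C. *)
Lemma integrable_gegenbauer_weight : mu.-integrable I (EFin \o w).
Proof.
have mw D : measurable_fun D (EFin \o w).
  by apply/measurable_EFinP; exact: measurable_gegenbauer_weight.
apply/integrableP; split; first exact: mw.
have w0 x : 0 <= w x by rewrite /gegenbauer_weight powR_ge0.
under eq_integral => x _ do rewrite /= ger0_norm ?w0//.
rewrite integral_itv_bndoo; last exact: mw.
have [C FC] := F_le.
have cvgJ : (\int[mu]_(x in J n) (w x)%:E @[n --> \oo] -->
    \int[mu]_(x in I0) (w x)%:E)%E%classic.
  rewrite -bigcup_J; apply: ge0_nondecreasing_set_cvg_integral => //.
  - apply/nondecreasing_seqP => n; rewrite subsetEset /J => x /=.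
    rewrite !in_itv/=.
    have : n.+4%:R^-1 <= n.+3%:R^-1 :> R by rewrite lef_pV2 ?posrE// ler_nat.
    by move: (n.+4%:R^-1) (n.+3%:R^-1) => u v; lra.
  - by move=> n; exact: measurable_itv.
  - by move=> n; exact: mw.
  - by move=> n x _; rewrite lee_fin.
apply: (@le_lt_trans _ _ (2 * C)%:E); last exact: ltry.
rewrite -(cvg_lim _ cvgJ)//; apply: lime_le.
  by apply/cvg_ex; eexists; exact: cvgJ.
apply: nearW => n.
have n0 : 0 < n.+3%:R^-1 :> R by rewrite invr_gt0.
have n3 : n.+3%:R^-1 <= 3^-1 :> R by rewrite lef_pV2 ?posrE// ler_nat.
rewrite /J; move: n0 n3; move: (n.+3%:R^-1) => e e0 e3.
have mG : measurable_fun `[-1 + e, 1 - e]%classic G.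
  apply: subspace_continuous_measurable_fun => //.
  apply: continuous_in_subspaceT => x; rewrite inE/= in_itv/= => /andP[ax xc].
  by apply: continuous_G; lra.
apply: (@le_trans _ _ (\int[mu]_(x in `[(-1 + e)%R, (1 - e)%R]) (G x)%:E)%E).
  apply: ge0_le_integral => //.
  - by move=> x _; rewrite lee_fin.
  - exact: mw.
  - by apply/measurable_EFinP.
  - move=> x /=; rewrite in_itv/= => x1; rewrite lee_fin /G.
    by apply: gegenbauer_weight_le; lra.
rewrite integral_G; [|lra..].
have /ler_normlP[F1 F2] : `|F (1 - e)| <= C by apply: FC; lra.
have /ler_normlP[F3 F4] : `|F (-1 + e)| <= C by apply: FC; lra.
by rewrite -EFinB lee_fin; lra.
Qed.
End gegenbauer_weight_theory.

(** * The integration functional: linearity, evenness, positivity *)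

Definition gegenbauer_functional (R : realType) (alpha : R) (p : {poly R}) :=
  \int[lebesgue_measure]_(x in `[-1, 1]%classic)
    (p.[x] * gegenbauer_weight alpha x).

Section gegenbauer_functional_theory.
Variables (R : realType) (alpha : R).
Hypothesis alpha_gt : - 2^-1 < alpha.
Local Notation mu := (@lebesgue_measure R).
Local Notation w := (gegenbauer_weight alpha).
Local Notation I := (`[(-1 : R), 1]%classic).
Local Notation L := (gegenbauer_functional alpha).
Implicit Types p q : {poly R}.

Lemma integrable_horner_weight p :
  mu.-integrable I (EFin \o (fun x => p.[x] * w x)).
Proof.
have mI : measurable I by exact: measurable_itv.
rewrite (_ : EFin \o _ = (EFin \o horner p) \* (EFin \o w))%E//.
apply: integrableMr => //; last exact: integrable_gegenbauer_weight.
  apply: measurable_funTS; apply: continuous_measurable_fun.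
  exact: continuous_horner.
have [||c cI cmax] := @EVT_max R (fun x => `|p.[x]|) (-1) 1; first lra.
  apply: continuous_subspaceT => x.
  apply: (continuous_comp (@continuous_horner _ p x)); exact: norm_continuous.
exists `|p.[c]|; split; first exact: num_real.
by move=> y cy x Ix; apply: le_trans (ltW cy); exact: cmax.
Qed.

Lemma gegenbauer_functionalD p q : L (p + q) = L p + L q.
Proof.
rewrite /gegenbauer_functional -RintegralD//;
  try exact: integrable_horner_weight.
by apply: eq_Rintegral => x _; rewrite hornerD mulrDl.
Qed.

Lemma gegenbauer_functionalZ a p : L (a *: p) = a * L p.
Proof.
rewrite /gegenbauer_functional -RintegralZl//;
  try exact: integrable_horner_weight.
by apply: eq_Rintegral => x _; rewrite hornerZ mulrA.
Qed.

(** Change of variable x -> - x: the weight is even, and both [-1, 1] and Lebesgue measure are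
    invariant under negation. *)
Lemma gegenbauer_functional_comp_opp p : L (p \Po - 'X) = L p.
Proof.
have pw x : (p \Po - 'X).[x] * w x = p.[- x] * w (- x).
  by rewrite horner_comp hornerN hornerX /gegenbauer_weight sqrrN.
have preI : ((-%R : _ -> measurableTypeR R) @^-1` I = I)%classic.
  by rewrite opp_preimage_itvbndbnd opprK.
rewrite /gegenbauer_functional /Rintegral; congr fine.
pose f : measurableTypeR R -> \bar R := fun x => (p.[x] * w x)%:E.
transitivity (\int[mu]_(x in I) (f \o -%R) x)%E.
  by apply: eq_integral => x _; rewrite pw.
rewrite -[in LHS]preI -integral_pushforward//.
- by apply: eq_measure_integral => //= A mA _; exact: lebesgue_measureN.
- apply/measurable_EFinP; apply: measurable_funM.
    by apply: continuous_measurable_fun; exact: continuous_horner.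
  exact: measurable_gegenbauer_weight.
- rewrite preI; have := integrable_horner_weight (p \Po - 'X).
  by apply: eq_integrable => // x _ /=; rewrite pw.
Qed.

Lemma gegenbauer_functional_sqr_ge0 p : 0 <= L (p ^+ 2).
Proof.
apply: Rintegral_ge0 => x _.
by rewrite mulr_ge0 ?powR_ge0// horner_exp sqr_ge0.
Qed.

Lemma horner_eq0_itv p : (forall x, -1 < x < 1 -> p.[x] = 0) -> p = 0.
Proof.
move=> H; apply/eqP; apply: contraT => p0.
(* The numbers 1/2, 1/3, ... are distinct points of ]-1, 1[, and [size p] of them are too many roots
   for a nonzero p. *)
pose rs := [seq (n.+2%:R)^-1 : R | n <- iota 0 (size p)].
have := max_poly_roots (rs := rs) p0; rewrite size_map size_iota ltnn.
move=> -> //.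
- apply/allP => _ /mapP[n _ ->]; apply/rootP/H.
  by rewrite (@lt_trans _ _ 0) ?invr_gt0// invf_lt1// ltr1n.
- rewrite map_inj_uniq ?iota_uniq// => m n /invr_inj/eqP.
  by rewrite eqr_nat => /eqP[].
Qed.

(** If p(x) is nonzero at some interior x, the nonnegative integrand stays above half its value at x
    on a small interval around x, so the integral is positive. *)
Lemma gegenbauer_functional_sqr_eq0 p : L (p ^+ 2) = 0 -> p = 0.
Proof.
move=> Lp; apply: horner_eq0_itv => x x1; apply/eqP; apply: contraT => px0.
have x2 : 0 < 1 - x ^+ 2 by nra.
pose g y := (p ^+ 2).[y] * w y.
have g0 y : 0 <= g y by rewrite mulr_ge0 ?powR_ge0// horner_exp sqr_ge0.
have gx0 : 0 < g x by rewrite mulr_gt0 ?powR_gt0// horner_exp exprn_even_gt0.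
have cg : {for x, continuous g}.
  apply: cvgM; first exact: continuous_horner.
  have [cw _] := is_derive1_powR (alpha - 2^-1) x2.
  apply: (@continuous_comp _ _ _ (fun y : R => 1 - y ^+ 2)
    (@powR R ^~ (alpha - 2^-1))).
    by apply: cvgB; [exact: cvg_cst|exact: exprn_continuous].
  by apply: differentiable_continuous; exact/derivable1_diffP.
have gx2 : g x / 2 < g x by lra.
have near_g : \forall y \near x, g x / 2 < g y by exact: (cvgr_gt (g x) cg).
have /nbhs_ballP[e /= e0 eg] := near_g.
(* The half of [e] puts the closed interval of radius [d] inside the open ball; the other two bounds
   keep it in [-1, 1]. *)
pose d := Num.min (e / 2) (Num.min (1 - x) (1 + x)).
have d0 : 0 < d by rewrite !lt_min; lra.
have [de [dx1 dx2]] : d <= e / 2 /\ d <= 1 - x /\ d <= 1 + x.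
  by rewrite !ge_min !lexx !orbT.
have mg : measurable_fun setT (EFin \o g).
  apply/measurable_EFinP; apply: measurable_funM.
    by apply: continuous_measurable_fun; exact: continuous_horner.
  exact: measurable_gegenbauer_weight.
have gI : (\int[mu]_(y in I) (g y)%:E = 0)%E.
  rewrite -[RHS]/(0%R%:E) -Lp /gegenbauer_functional /Rintegral fineK//.
  by apply: integrable_fin_num => //; exact: integrable_horner_weight.
pose J := `[(x - d), (x + d)]%classic.
have mJ : measurable J by exact: measurable_itv.
have : (\int[mu]_(y in J) (cst (g x / 2)%:E) y <= \int[mu]_(y in I) (g y)%:E)%E.
  apply: (@le_trans _ _ (\int[mu]_(y in J) (g y)%:E)%E).
    apply: ge0_le_integral => //.
    - by move=> y _; rewrite /= lee_fin; lra.
    - exact: measurable_funTS.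
    - move=> y; rewrite /J /= in_itv/= => yd; rewrite lee_fin ltW//.
      by apply: eg; rewrite /ball/= ltr_norml; lra.
  apply: ge0_subset_integral => //.
  - exact: measurable_funTS.
  - by move=> y _; rewrite lee_fin.
  - by move=> y; rewrite /J /= !in_itv/=; lra.
have muJ : (mu J = (x + d - (x - d))%:E)%E.
  by rewrite /J lebesgue_measure_itv/= lte_fin ifT ?EFinB//; lra.
rewrite integral_cst// gI [X in (_ * X)%E]muJ -EFinM lee_fin => H.
have : 0 < g x / 2 * (x + d - (x - d)) by rewrite mulr_gt0; lra.
by rewrite ltNge H.
Qed.

End gegenbauer_functional_theory.

(** * Parity of the Sobolev orthogonal polynomials *)

Section sobolev_symmetry.
Variables (R : realType) (alpha lambda : R).
Hypotheses (alpha_gt : - 2^-1 < alpha) (lambda0 : 0 <= lambda).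
Local Notation L := (gegenbauer_functional alpha).
Local Notation Sob := (sobolev_product alpha lambda).
Implicit Types f g : {poly R}.

Lemma sobolev_productE f g : Sob f g = L (f * g) + lambda * L (f^`() * g^`()).
Proof.
rewrite /sobolev_product; congr (_ + lambda * _);
  by apply: eq_Rintegral => x _; rewrite hornerM.
Qed.

Lemma sobolev_productC f g : Sob f g = Sob g f.
Proof. by rewrite !sobolev_productE mulrC [f^`() * _]mulrC. Qed.

Lemma sobolev_product_linear a f g h :
  Sob f (a *: g + h) = a * Sob f g + Sob f h.
Proof.
rewrite !sobolev_productE derivD derivZ (mulrDr f) (mulrDr f^`()).
rewrite -(scalerAr a f) -(scalerAr a f^`()).
rewrite !gegenbauer_functionalD// !gegenbauer_functionalZ//; ring.
Qed.

Lemma sobolev_product0r f : Sob f 0 = 0.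
Proof.
have := gegenbauer_functionalZ alpha_gt 0 0; rewrite scale0r mul0r => L0.
by rewrite sobolev_productE deriv0 !mulr0 L0 mulr0 addr0.
Qed.

Lemma sobolev_product_comp_opp f g : Sob (f \Po - 'X) g = Sob f (g \Po - 'X).
Proof.
rewrite !sobolev_productE.
have compN2 h : (h \Po - 'X) \Po - 'X = h :> {poly R}.
  by rewrite -comp_polyA rmorphN/= comp_polyX opprK comp_polyXr.
have derivN_comp h : (h \Po - 'X)^`() = - (h^`() \Po - 'X) :> {poly R}.
  by rewrite deriv_comp derivN derivX mulrN1.
congr (_ + lambda * _).
  by rewrite -[LHS]gegenbauer_functional_comp_opp// comp_polyM compN2.
rewrite -[LHS]gegenbauer_functional_comp_opp// !derivN_comp comp_polyM.
by rewrite rmorphN/= compN2 mulNr mulrN.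
Qed.

Lemma sobolev_product_eq0 f : Sob f f = 0 -> f = 0.
Proof.
rewrite sobolev_productE -!expr2 => H.
apply: (gegenbauer_functional_sqr_eq0 alpha_gt).
have := gegenbauer_functional_sqr_ge0 alpha f.
have := mulr_ge0 lambda0 (gegenbauer_functional_sqr_ge0 alpha f^`()); lra.
Qed.

Variable Q : nat -> {poly R}.
Hypothesis Q_orth : monic_sobolev_orthogonal alpha lambda Q.

(** Subtracting the multiple of [Q m] with the same coefficient of degree m lowers the size bound of
    [g]; only indices m < n occur, and those [Q m] are orthogonal to [Q n]. *)
Lemma sobolev_orthogonal_lt n g : (size g <= n)%N -> Sob (Q n) g = 0.
Proof.
have [Qsize Qmonic Qorth] := Q_orth.
suff H m : (m <= n)%N -> forall g, (size g <= m)%N -> Sob (Q n) g = 0.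
  exact: H.
elim: m => [_ {}g|m IH mn {}g gm].
  by rewrite leqn0 size_poly_eq0 => /eqP->; rewrite sobolev_product0r.
have -> : g = g`_m *: Q m + (g - g`_m *: Q m) by rewrite addrC subrK.
rewrite sobolev_product_linear Qorth; last by move=> nm; rewrite nm ltnn in mn.
rewrite mulr0 add0r; apply: IH; first exact: ltnW.
apply/leq_sizeP => j; rewrite leq_eqVlt coefB coefZ => /predU1P[<-|mj].
  have /monicP := Qmonic m; rewrite lead_coefE Qsize/= => ->.
  by rewrite mulr1 subrr.
by rewrite (nth_default 0 (leq_trans gm mj)) (@nth_default _ _ (Q m)) ?Qsize//
  mulr0 subrr.
Qed.

(** The leading terms cancel in [d], so its degree is below n and it is orthogonal to [Q n]. Moving
    the reflection to the other argument shows that it is also orthogonal to the reflected [Q n].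
    Hence [d] is orthogonal to itself and vanishes by definiteness. *)
Lemma sobolev_orthogonal_sym n : Q n \Po - 'X = (-1) ^+ n *: Q n.
Proof.
have [Qsize Qmonic _] := Q_orth.
have sizeN g : size (g \Po - 'X) = size g.
  by rewrite size_comp_poly2// size_polyN size_polyX.
pose d := (-1) ^+ n *: (Q n \Po - 'X) + - Q n.
have d_size : (size d <= n)%N.
  apply/leq_sizeP => j; rewrite leq_eqVlt coefD coefZ coefN => /predU1P[<-|nj].
    have /monicP := Qmonic n; rewrite lead_coefE Qsize/= => ->.
    have : lead_coef (Q n \Po - 'X) = (-1) ^+ n.
      rewrite lead_coef_comp ?size_polyN ?size_polyX// lead_coefN lead_coefX.
      by rewrite (monicP (Qmonic n)) Qsize mul1r.
    by rewrite lead_coefE sizeN Qsize/= => ->; rewrite -expr2 sqrr_sign subrr.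
  by rewrite !nth_default ?mulr0 ?subrr ?sizeN ?Qsize.
have d0 : d = 0.
  apply: sobolev_product_eq0; rewrite {2}/d sobolev_product_linear.
  rewrite -[- Q n]scaleN1r -[_ *: Q n]addr0 sobolev_product_linear.
  rewrite sobolev_productC sobolev_product_comp_opp.
  rewrite sobolev_orthogonal_lt ?sizeN//.
  rewrite [Sob d (Q n)]sobolev_productC sobolev_orthogonal_lt//.
  by rewrite sobolev_product0r !mulr0 !addr0.
have /eqP := d0; rewrite /d subr_eq0 => /eqP QE.
by rewrite -[in RHS]QE scalerA -expr2 sqrr_sign scale1r.
Qed.

End sobolev_symmetry.

Theorem theorem3p2 (R : realType) (alpha lambda : R) (Q : nat -> {poly R})
    (n k : nat) (M : R) :
  - 2^-1 < alpha -> 0 <= lambda ->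
  monic_sobolev_orthogonal alpha lambda Q ->
  is_sobolev_point n (Q n) M ->
  (1 <= k <= n)%N ->
  let dq := fun x : R => `|(normalized_at (Q n) M)^`(k).[x]| in
  attains_max_at dq (- M) M (- M) /\ attains_max_at dq (- M) M M.
Proof.
move=> alpha_gt lambda0 HQ HM /andP[k1 kn].
have n0 : (0 < n)%N by exact: leq_trans kn.
have Qsym := sobolev_orthogonal_sym alpha_gt lambda0 HQ n.
have [Qsize Qmonic _] := HQ.
have [M0 osc] := sobolev_point_oscillating n0 (Qsize n) (Qmonic n)
  (sqrr_sign _ n) Qsym HM.
have [[L1 L2] [R1 R2]] :=
  oscillating_attains_max M0 (oscillating_derivn k M0 osc).
have dqE x : `|(normalized_at (Q n) M)^`(k).[x]| =
    `|((Q n).[M])^-1| * `|(Q n)^`(k).[x]|.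
  by rewrite /normalized_at derivnZ hornerZ normrM.
split; split=> // t tM; rewrite !dqE ler_wpM2l//; [exact: L2|exact: R2].
Qed.
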